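(* Consider the multivariate allometric regression model described in the context, and let $0\le w\le 1$. Put \[ a = \mathrm{tr}(\boldsymbol{\Sigma}^2) + (\mathrm{tr}(\boldsymbol{\Sigma}))^2,\quad b = \lambda_1 + \mathrm{tr}(\boldsymbol{\Sigma}),\quad c = \| \boldsymbol{X}\boldsymbol{\alpha} \|^2,\quad d = \lambda_1-\lambda_2 . \] Then \[ \mathbb{E}\left[ \min_{\theta\in\{-1,1\}} \| \theta \hat{\boldsymbol{\gamma}}_1(w) - \boldsymbol{\gamma}_1 \|^2 \right] \le \frac{8 a \{ q(1-2w) + (n-1)w^2 \} + 16\, bc\, (1-w)^2}{\left[ d\{ q + (n-1-2q)w \} + c(1-w) \right]^2}. \]
   Context: Model. Let $n,p,q$ be positive integers with $p\ge 2$ and $n>1+q$. Let $\boldsymbol{X}$ be a deterministic real $n\times q$ matrix with $\mathrm{rank}(\boldsymbol{X})=q$ and $\boldsymbol{X}'\boldsymbol{1}_n=\boldsymbol{0}_q$ (here $'$ is transpose and $\boldsymbol{1}_n$ is the all-ones vector), $\boldsymbol{\mu}\in\mathbb{R}^p$, $\boldsymbol{\alpha}\in\mathbb{R}^q$. Let $\boldsymbol{\Sigma}$ be a $p\times p$ positive-definite matrix with eigenvalues $\lambda_1>\lambda_2\ge\cdots\ge\lambda_p>0$, and let $\boldsymbol{\gamma}_1$ be a unit eigenvector of $\boldsymbol{\Sigma}$ for $\lambda_1$. The observed $n\times p$ matrix is \[ \boldsymbol{Y} = \boldsymbol{1}_n\boldsymbol{\mu}' + \boldsymbol{X}\boldsymbol{\alpha}\boldsymbol{\gamma}_1'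 + \boldsymbol{E},\qquad \mathrm{vec}(\boldsymbol{E})\sim \mathcal{N}_{np}(\boldsymbol{0}_{np},\boldsymbol{\Sigma}\otimes \boldsymbol{I}_n), \] i.e. the rows of $\boldsymbol{E}$ are i.i.d. $\mathcal{N}_p(\boldsymbol{0}_p,\boldsymbol{\Sigma})$. Estimators. Let \[ \boldsymbol{S}_R = \boldsymbol{Y}'\boldsymbol{X}(\boldsymbol{X}'\boldsymbol{X})^{-1}\boldsymbol{X}'\boldsymbol{Y},\qquad \boldsymbol{S}_E = \boldsymbol{Y}'\Bigl\{ \boldsymbol{I}_n - \tfrac1n\boldsymbol{1}_n\boldsymbol{1}_n' - \boldsymbol{X}(\boldsymbol{X}'\boldsymbol{X})^{-1}\boldsymbol{X}' \Bigr\}\boldsymbol{Y}, \] and $\boldsymbol{S}(w) = (1-w)\boldsymbol{S}_R + w\boldsymbol{S}_E$ for $0\le w\le 1$. The estimator $\hat{\boldsymbol{\gamma}}_1(w)$ is the first principal eigenvector of $\boldsymbol{S}(w)$, i.e. a unit eigenvector of $\boldsymbol{S}(w)$ corresponding to its largest eigenvalue. $\|\cdot\|$ is the Euclidean norm. *)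

(* Defs.v *)
From mathcomp Require Import all_boot all_order all_algebra.
From mathcomp Require Import all_classical all_reals all_analysis.
From mathcomp Require Export mxtens.

Set Implicit Arguments.
Unset Strict Implicit.
Unset Printing Implicit Defensive.

Import Order.TTheory GRing.Theory Num.Theory.
Import numFieldNormedType.Exports.

Local Open Scope classical_set_scope.
Local Open Scope ring_scope.

(* The norm that MathComp-Analysis puts on matrices is the sup norm. *)
Definition enorm {R : realType} {k : nat} (v : 'cV[R]_k) : R :=
  Num.sqrt (\sum_(i < k) v i 0 ^+ 2).

Definition posdef {R : realType} {k : nat} (A : 'M[R]_k) : Prop :=
  A^T = A /\ forall v : 'cV[R]_k, v != 0 -> 0 < (v^T *m A *m v) 0 0.

(* lam lists the eigenvalues of A, repeated according to multiplicity. *)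
Definition eigenvalues_of {R : realType} {k : nat}
    (A : 'M[R]_k) (lam : k.-tuple R) : Prop :=
  char_poly A = \prod_(l <- lam) ('X - l%:P).

Definition principal_eigenvector {R : realType} {k : nat}
    (A : 'M[R]_k) (v : 'cV[R]_k) : Prop :=
  enorm v = 1 /\
  exists l : R, A *m v = l *: v /\ forall m : R, eigenvalue A m -> m <= l.

(* Column stacking: entry (i, j) of A sits at position j * n + i, which is the
   indexing under which the covariance of vec is a Kronecker product V *t U
   with U acting on the rows of A and V on its columns. *)
Definition vec {R : realType} {n p : nat} (A : 'M[R]_(n, p)) : 'cV[R]_(p * n) :=
  \col_k A (mxtens_unindex k).2 (mxtens_unindex k).1.

Definition random_mx {d : measure_display} {T : measurableType d}
    {R : realType} {m k : nat} (Z : T -> 'M[R]_(m, k)) : Prop :=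
  forall i j, measurable_fun [set: T] (fun x => Z x i j).

(* normal_prob takes the standard deviation, and is the uniform law on [0, 1]
   when it is 0; the normal law with variance 0 is the Dirac mass. *)
Definition normal_law {R : realType} (m v : R) (A : set R) : \bar R :=
  if v == 0 then \d_m A else normal_prob m (Num.sqrt v) A.

(* Z ~ N_k(m, V): every linear combination t'Z is N(t'm, t'Vt). *)
Definition mvnormal {d : measure_display} {T : measurableType d}
    {R : realType} (P : probability T R) {k : nat}
    (Z : T -> 'cV[R]_k) (m : 'cV[R]_k) (V : 'M[R]_k) : Prop :=
  random_mx Z /\
  forall (t : 'cV[R]_k) (A : set R), measurable A ->
    pushforward P (fun x => (t^T *m Z x) 0 0) A =
    normal_law ((t^T *m m) 0 0) ((t^T *m V *m t) 0 0) A.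

Definition ones {R : realType} (n : nat) : 'cV[R]_n := const_mx 1.

(* The value of Y when the error matrix is E. *)
Definition allometric_response {R : realType} {n p q : nat}
    (X : 'M[R]_(n, q)) (mu : 'cV[R]_p) (alpha : 'cV[R]_q) (gamma1 : 'cV[R]_p)
    (E : 'M[R]_(n, p)) : 'M[R]_(n, p) :=
  ones n *m mu^T + X *m alpha *m gamma1^T + E.

Definition hat_mx {R : realType} {n q : nat} (X : 'M[R]_(n, q)) : 'M[R]_n :=
  X *m invmx (X^T *m X) *m X^T.

Definition S_R {R : realType} {n p q : nat}
    (X : 'M[R]_(n, q)) (Y : 'M[R]_(n, p)) : 'M[R]_p :=
  Y^T *m hat_mx X *m Y.

Definition S_E {R : realType} {n p q : nat}
    (X : 'M[R]_(n, q)) (Y : 'M[R]_(n, p)) : 'M[R]_p :=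
  Y^T *m (1%:M - n%:R^-1 *: (ones n *m (ones n)^T) - hat_mx X) *m Y.

Definition S_w {R : realType} {n p q : nat}
    (X : 'M[R]_(n, q)) (w : R) (Y : 'M[R]_(n, p)) : 'M[R]_p :=
  (1 - w) *: S_R X Y + w *: S_E X Y.

(* Main.v *)
Require Import Defs.
From mathcomp Require Import all_boot all_order all_algebra.
From mathcomp Require Import complex.
From mathcomp Require Import all_classical all_reals all_analysis.
From mathcomp Require Import measurable_realfun.
From mathcomp Require Import ring lra.

Set Implicit Arguments.
Unset Strict Implicit.
Unset Printing Implicit Defensive.

Import Order.TTheory GRing.Theory Num.Theory.
Import numFieldNormedType.Exports.

Local Open Scope classical_set_scope.
Local Open Scope ring_scope.

(* M denotes the matrix (1 - w) H + w (I - J - H) with H the hat matrix and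
   J = 11'/n, so that S(w) = Y'MY, M 1 = 0, M X = (1 - w) X, tr M = tau and
   tr M^2 = q (1 - 2w) + (n - 1) w^2. Hence S(w) - Q, where
   Q = tau Sigma + (1 - w) c gamma gamma', is the sum of the centred quadratic
   form E'ME - tau Sigma and of (1 - w) (gamma z' + z gamma') with
   z = E'X alpha. Isserlis' formula and the vanishing of the odd moments give
   E |S(w) - Q|^2 = a tr M^2 + 2 b c (1 - w)^2 for the Frobenius norm. Finally
   gamma is the top eigenvector of Q with spectral gap d tau + c (1 - w), and
   Davis-Kahan bounds the error by 4 |S(w) - Q|^2 / gap^2; the constants of the
   theorem leave a factor 2 unused. *)

(** * Rayleigh quotients and perturbation of the principal eigenvector *)

(** [Q] is the mean of [S(w)], and the perturbation bound is applied outcome by outcome with the gap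
    of this deterministic matrix. The denominator is therefore a constant, the spectral gap of the
    random [S(w)] is never estimated, and only a mean of polynomials in the entries of [E] is left
    to compute.

    Normality is given through the laws of linear forms. Every joint moment of the entries of [E]
    thus has to come from one-dimensional moments of order at most 4, by polarisation; a form of
    variance 0 has a Dirac law and is treated apart.

    The Rayleigh bounds rest on a unitary diagonalisation [U = a + i b] of a real symmetric matrix.
    For a real vector [v], the weights |(U v)_i|^2 = (a v)_i^2 + (b v)_i^2 are all that a quadratic
    form sees, so no real orthonormal eigenbasis has to be constructed. *)

Lemma Re_sum (R : realType) (I : Type) (r : seq I) (F : I -> R[i]) :
  complex.Re (\sum_(i <- r) F i) = \sum_(i <- r) complex.Re (F i).
Proof. by rewrite (big_morph _ (id1 := 0) (op1 := +%R) _ _)// => -[? ?] []. Qed.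

Lemma Im_sum (R : realType) (I : Type) (r : seq I) (F : I -> R[i]) :
  complex.Im (\sum_(i <- r) F i) = \sum_(i <- r) complex.Im (F i).
Proof. by rewrite (big_morph _ (id1 := 0) (op1 := +%R) _ _)// => -[? ?] []. Qed.

(* The unitary diagonalisation U of A over R[i], split as U = a + i b. *)
Lemma symmetric_spectral (R : realType) (k : nat) (A : 'M[R]_k) : A^T = A ->
  exists (D : 'rV[R]_k) (a b : 'M[R]_k),
    [/\ char_poly A = \prod_(i < k) ('X - (D 0 i)%:P),
        a *m A = diag_mx D *m a, b *m A = diag_mx D *m b,
        a^T *m a + b^T *m b = 1%:M & a^T *m b = b^T *m a].
Proof.
move=> Asym; pose AC := map_mx (real_complex R) A.
have AChm : AC \is hermsymmx.
  apply: realsym_hermsym.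
    apply/is_hermitianmxP; rewrite expr0 scale1r.
    by apply/matrixP => i j; rewrite !mxE -{1}Asym mxE.
  apply/mxOverP => i j; rewrite mxE; by apply/complex_realP; exists (A i j).
have [U [d [Uu dr AE]]] : exists (U : 'M[R[i]]_k) (d : 'rV[R[i]]_k),
    [/\ U \is unitarymx, d \is a mxOver Num.real
      & AC = invmx U *m diag_mx d *m U].
  exists (spectralmx AC), (spectral_diag AC); split.
  - exact: spectral_unitarymx.
  - exact: hermitian_spectral_diag_real.
  - by have /orthomx_spectralP := hermitian_normalmx AChm.
have dE i : d 0 i = (complex.Re (d 0 i))%:C%C.
  by rewrite RRe_real//; exact: (mxOverP dr).
have Uinv := unitarymx_unit Uu.
pose a := map_mx (@complex.Re R) U; pose b := map_mx (@complex.Im R) U.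
pose D := map_mx (@complex.Re R) d.
have UA : U *m AC = diag_mx d *m U by rewrite AE !mulmxA mulmxV// mul1mx.
have UAE i j : \sum_l U i l * (A l j)%:C%C = (complex.Re (d 0 i))%:C%C * U i j.
  have /matrixP/(_ i j) := UA; rewrite mul_diag_mx !mxE -dE => <-.
  by apply: eq_bigr => l _; rewrite mxE.
have UUE i j : \sum_l conjc (U l i) * U l j = (i == j)%:R.
  have : map_mx Num.conj U^T *m U = 1%:M by rewrite -invmx_unitary// mulVmx.
  move=> /matrixP/(_ i j); rewrite !mxE => <-.
  by apply: eq_bigr => l _; rewrite !mxE.
exists D, a, b; split.
- apply: (@map_inj_poly _ _ (real_complex R)) => //; first exact: complexI.
  rewrite map_char_poly -/AC AE rmorph_prod/=.
  (* Similar matrices have the same characteristic polynomial: ['X%:M] commutes with [U], so [U] and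
     its inverse factor out on both sides and their determinants cancel. *)
  have simU : char_poly (invmx U *m diag_mx d *m U) = char_poly (diag_mx d).
    rewrite /char_poly /char_poly_mx !map_mxM/=.
    have XE : 'X%:M = map_mx polyC (invmx U) *m 'X%:M *m map_mx polyC U :> 'M[{poly R[i]}]_k.
      by rewrite scalar_mxC -mulmxA -map_mxM mulVmx// map_mx1 mulmx1.
    rewrite [in LHS]XE -mulmxBl -mulmxBr !det_mulmx mulrAC -det_mulmx -map_mxM mulVmx//.
    by rewrite map_mx1 det1 mul1r.
  rewrite simU char_poly_trig ?diag_mx_is_trig//.
  by apply: eq_bigr => i _; rewrite !mxE eqxx mulr1n map_polyXsubC /= -dE.
- apply/matrixP => i j; rewrite mul_diag_mx !mxE.
  have := congr1 (@complex.Re R) (UAE i j); rewrite Re_sum /=.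
  case: (U i j) => x y /=; rewrite mul0r subr0 => <-.
  apply: eq_bigr => l _; rewrite !mxE.
  by case: (U i l) => x' y' /=; rewrite mulr0 subr0.
- apply/matrixP => i j; rewrite mul_diag_mx !mxE.
  have := congr1 (@complex.Im R) (UAE i j); rewrite Im_sum /=.
  case: (U i j) => x y /=; rewrite mul0r addr0 => <-.
  apply: eq_bigr => l _; rewrite !mxE.
  by case: (U i l) => x' y' /=; rewrite mulr0 add0r.
(* The last two identities are the real and the imaginary part of [U^* U = 1]. *)
- apply/matrixP => i j; rewrite [LHS]mxE [X in X + _]mxE [X in _ + X]mxE.
  have := congr1 (@complex.Re R) (UUE i j); rewrite Re_sum.
  have -> : complex.Re ((i == j)%:R : R[i]) = (1%:M : 'M[R]_k) i j.
    by rewrite mxE; case: (i == j).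
  move=> <-; rewrite -big_split/=; apply: eq_bigr => l _; rewrite !mxE.
  by case: (U l i) (U l j) => x y [x' y'] /=; rewrite mulNr opprK.
- apply/matrixP => i j; have := congr1 (@complex.Im R) (UUE i j).
  rewrite Im_sum.
  have -> : complex.Im ((i == j)%:R : R[i]) = 0 by case: (i == j).
  move=> Uij; apply/eqP; rewrite -subr_eq0; apply/eqP; rewrite -[RHS]Uij.
  rewrite mxE [X in _ - X]mxE -sumrB; apply: eq_bigr => l _; rewrite !mxE.
  by case: (U l i) (U l j) => x y [x' y'] /=; rewrite mulNr.
Qed.

Lemma enorm_sqr (R : realType) (k : nat) (v : 'cV[R]_k) :
  enorm v ^+ 2 = (v^T *m v) 0 0.
Proof.
rewrite /enorm sqr_sqrtr; last by apply: sumr_ge0 => i _; exact: sqr_ge0.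
by rewrite mxE; apply: eq_bigr => i _; rewrite mxE expr2.
Qed.

Lemma quad_diag_mx (R : realType) (k : nat) (D : 'rV[R]_k) (u : 'cV[R]_k) :
  (u^T *m diag_mx D *m u) 0 0 = \sum_i D 0 i * u i 0 ^+ 2.
Proof.
rewrite -mulmxA mul_diag_mx mxE; apply: eq_bigr => i _.
by rewrite !mxE mulrCA.
Qed.

Lemma sqnormE (R : realType) (k : nat) (u : 'cV[R]_k) :
  (u^T *m u) 0 0 = \sum_i u i 0 ^+ 2.
Proof. by rewrite mxE; apply: eq_bigr => i _; rewrite mxE expr2. Qed.

(** Parseval's identity: the bracket is |(U v)_i|^2 for [U = a + i b]. Both forms carry the same
    nonnegative weights, so a Rayleigh bound reduces to comparing the numbers [D 0 i] one by one. *)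
Lemma quad_spectral (R : realType) (k : nat) (A a b : 'M[R]_k) (D : 'rV[R]_k)
    (v : 'cV[R]_k) :
  a *m A = diag_mx D *m a -> b *m A = diag_mx D *m b ->
  a^T *m a + b^T *m b = 1%:M ->
  (v^T *m A *m v) 0 0 =
    \sum_i D 0 i * ((a *m v) i 0 ^+ 2 + (b *m v) i 0 ^+ 2) /\
  (v^T *m v) 0 0 = \sum_i ((a *m v) i 0 ^+ 2 + (b *m v) i 0 ^+ 2).
Proof.
move=> aA bA ab1; split.
  have -> : v^T *m A *m v = (a *m v)^T *m diag_mx D *m (a *m v)
                          + (b *m v)^T *m diag_mx D *m (b *m v).
    rewrite !trmx_mul -!mulmxA ![diag_mx D *m (_ *m v)]mulmxA -aA -bA -!mulmxA.
    by rewrite -mulmxDr [a^T *m _]mulmxA [b^T *m _]mulmxA -mulmxDl ab1 mul1mx.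
  rewrite mxE !quad_diag_mx -big_split; apply: eq_bigr => i _.
  by rewrite /= -mulrDr.
have -> : v^T *m v = (a *m v)^T *m (a *m v) + (b *m v)^T *m (b *m v).
  rewrite !trmx_mul -!mulmxA -mulmxDr [a^T *m _]mulmxA [b^T *m _]mulmxA.
  by rewrite -mulmxDl ab1 mul1mx.
by rewrite mxE !sqnormE -big_split.
Qed.

Lemma symmetric_rayleigh_le (R : realType) (k : nat) (A : 'M[R]_k) (l : R)
    (v : 'cV[R]_k) :
  A^T = A -> (forall m, eigenvalue A m -> m <= l) ->
  (v^T *m A *m v) 0 0 <= l * (v^T *m v) 0 0.
Proof.
move=> /symmetric_spectral[D [a [b [cA aA bA ab1 _]]]] le_l.
have [-> ->] := quad_spectral v aA bA ab1.
rewrite mulr_sumr ler_sum// => i _.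
rewrite ler_wpM2r ?addr_ge0 ?sqr_ge0//; apply: le_l.
rewrite eigenvalue_root_char cA; apply/rootP/eqP; rewrite horner_prod.
by apply/prodf_eq0; exists i; rewrite // hornerXsubC subrr.
Qed.

(* lam`_0 being simple, the only nonzero spectral coordinate of gamma sits at
   the index i0 of lam`_0; orthogonality to gamma then kills the coordinate
   of v there. *)
Lemma symmetric_rayleigh_le_orth (R : realType) (k : nat) (A : 'M[R]_k)
    (lam : k.-tuple R) (gamma v : 'cV[R]_k) :
  (2 <= k)%N ->
  A^T = A -> eigenvalues_of A lam -> sorted >=%R lam -> lam`_0 > lam`_1 ->
  gamma != 0 -> A *m gamma = lam`_0 *: gamma -> (v^T *m gamma) 0 0 = 0 ->
  (v^T *m A *m v) 0 0 <= lam`_1 * (v^T *m v) 0 0.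
Proof.
move=> k2 /symmetric_spectral[D [a [b [cA aA bA ab1 abC]]]] clam slam lam01 g0 Ag vg.
have Dlam : perm_eq [seq D 0 i | i <- enum 'I_k] lam.
  by apply: prod_XsubC_eq; rewrite -clam cA big_map big_enum.
have szlam := size_tuple lam.
have lamE : (lam : seq R) = lam`_0 :: behead lam by case: (tval lam) szlam k2 => [<-|].
have le1 x : x \in behead lam -> x <= lam`_1.
  case: (tval lam) szlam slam => [|x0 [|x1 s]] //= _.
  move=> /andP[_ ps]; rewrite inE => /predU1P[->//|xs].
  have := order_path_min (fun _ _ _ h h' => le_trans h' h) ps.
  by move=> /allP/(_ _ xs).
(* [D] lists the eigenvalues in no particular order. Once a copy of the top eigenvalue is removed
   from [D] and from [lam], the remaining lists are permutations of each other, and the tail of the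
   sorted [lam] is bounded by its own head. *)
have [i0 [Di0 Dle]] : exists i0, D 0 i0 = lam`_0 /\
    forall i, i != i0 -> D 0 i <= lam`_1.
  have : lam`_0 \in [seq D 0 i | i <- enum 'I_k].
    by rewrite (perm_mem Dlam) mem_nth// szlam; exact: leq_trans k2.
  move=> /mapP[i0 _ Di0]; exists i0; split=> // i ii0.
  apply: le1; have := Dlam.
  rewrite {1}lamE => /permP H.
  have i0k : i0 \in enum 'I_k by rewrite mem_enum.
  have /permP Q := perm_map (D 0) (perm_to_rem i0k).
  have pe : perm_eq [seq D 0 j | j <- rem i0 (enum 'I_k)] (behead lam).
    by apply/permP => f; have := H f; rewrite Q/= Di0 => /addnI.
  rewrite -(perm_mem pe); apply: map_f.
  by rewrite mem_rem_uniq ?enum_uniq// inE ii0 mem_enum.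
have coord0 (c : 'M[R]_k) i : c *m A = diag_mx D *m c -> i != i0 ->
    (c *m gamma) i 0 = 0.
  move=> cA' ii0; have : diag_mx D *m (c *m gamma) = lam`_0 *: (c *m gamma).
    by rewrite mulmxA -cA' -mulmxA Ag scalemxAr.
  move=> /matrixP/(_ i 0); rewrite mul_diag_mx !mxE => /eqP.
  rewrite -subr_eq0 -mulrBl mulf_eq0 => /orP[|/eqP//].
  by rewrite subr_eq0 => /eqP Di; have := Dle _ ii0; rewrite Di leNgt lam01.
have supp (c e : 'M[R]_k) : e *m A = diag_mx D *m e ->
    ((c *m v)^T *m (e *m gamma)) 0 0 = (c *m v) i0 0 * (e *m gamma) i0 0.
  move=> eA; rewrite mxE (bigD1 i0)//= big1 ?addr0 => [|i ii0]; first by rewrite mxE.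
  by rewrite (coord0 e)// mulr0.
(* [e1] and [e2] are the real and imaginary parts of conj((U v)_i0) (U gamma)_i0 = 0, and [e3] says
   that (U gamma)_i0 is nonzero; hence (U v)_i0 = 0. *)
have e1 : (a *m v) i0 0 * (a *m gamma) i0 0 + (b *m v) i0 0 * (b *m gamma) i0 0 = 0.
  rewrite -!supp// -[RHS]vg -[in RHS](mul1mx gamma) -ab1 mulmxDl mulmxDr.
  by rewrite !trmx_mul !mulmxA [RHS]mxE.
have e2 : (a *m v) i0 0 * (b *m gamma) i0 0 = (b *m v) i0 0 * (a *m gamma) i0 0.
  by rewrite -!supp// !trmx_mul -!mulmxA [a^T *m _]mulmxA abC !mulmxA.
have e3 : (a *m gamma) i0 0 ^+ 2 + (b *m gamma) i0 0 ^+ 2 != 0.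
  have [_] := quad_spectral gamma aA bA ab1.
  rewrite (bigD1 i0)//= big1 ?addr0 => [<-|i ii0]; last first.
    by rewrite !coord0// expr0n addr0.
  rewrite sqnormE psumr_eq0 => [|i _]; last exact: sqr_ge0.
  apply: contra g0 => /allP h; apply/eqP/matrixP => i j; rewrite ord1 mxE.
  by apply/eqP; rewrite -sqrf_eq0; exact: h (mem_index_enum i).
have [av bv] : (a *m v) i0 0 = 0 /\ (b *m v) i0 0 = 0.
  move: e1 e2 e3; move: ((a *m v) i0 0) ((b *m v) i0 0) ((a *m gamma) i0 0)
    ((b *m gamma) i0 0) => x y s t e1 e2 e3.
  have xs : x * (s ^+ 2 + t ^+ 2) = 0.
    transitivity (s * (x * s + y * t) + t * (x * t - y * s)); first by ring.
    by rewrite e1 e2 subrr !mulr0 addr0.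
  have ys : y * (s ^+ 2 + t ^+ 2) = 0.
    transitivity (t * (x * s + y * t) - s * (x * t - y * s)); first by ring.
    by rewrite e1 e2 subrr !mulr0 subr0.
  by split; apply/eqP; [move/eqP: xs|move/eqP: ys]; rewrite mulf_eq0 (negbTE e3) orbF.
have [-> ->] := quad_spectral v aA bA ab1.
rewrite mulr_sumr ler_sum// => i _; have [->|ii0] := eqVneq i i0.
  by rewrite av bv expr0n addr0 !mulr0.
by rewrite ler_wpM2r ?addr_ge0 ?sqr_ge0// Dle.
Qed.

(* Davis-Kahan, in the variational form of Yu, Wang and Samworth. *)
Lemma principal_eigenvector_perturbation (R : realType) (k : nat)
    (S Q : 'M[R]_k) (g gamma : 'cV[R]_k) (kappa beta : R) :
  S^T = S -> Q^T = Q -> principal_eigenvector S g -> enorm gamma = 1 ->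
  Q *m gamma = kappa *: gamma -> beta < kappa ->
  (forall v : 'cV[R]_k, (v^T *m gamma) 0 0 = 0 ->
    (v^T *m Q *m v) 0 0 <= beta * (v^T *m v) 0 0) ->
  Num.min (enorm ((-1) *: g - gamma) ^+ 2) (enorm (1 *: g - gamma) ^+ 2)
    <= 4 * (\sum_i \sum_j (S i j - Q i j) ^+ 2) / (kappa - beta) ^+ 2.
Proof.
move=> Ssym Qsym [g1 [l [Sg lmax]]] gam1 Qgam lt_bk Qorth.
have gg : (g^T *m g) 0 0 = 1 by rewrite -enorm_sqr g1 expr1n.
have cc : (gamma^T *m gamma) 0 0 = 1 by rewrite -enorm_sqr gam1 expr1n.
set s := (g^T *m gamma) 0 0.
have add00 (A B : 'M[R]_1) : (A + B) 0 0 = A 0 0 + B 0 0 by rewrite mxE.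
have opp00 (A : 'M[R]_1) : (- A) 0 0 = - A 0 0 by rewrite mxE.
have scale00 c (A : 'M[R]_1) : (c *: A) 0 0 = c * A 0 0 by rewrite mxE.
have E00 := (add00, opp00, scale00).
have sC : (gamma^T *m g) 0 0 = s.
  by rewrite /s -[in LHS](trmxK g) -trmx_mul mxE.
have gammaQ : gamma^T *m Q = kappa *: gamma^T.
  by rewrite -[in LHS]Qsym -trmx_mul Qgam linearZ.
(* [s] is the cosine of the angle between [g] and [gamma]. Since [gamma] is an eigenvector of [Q],
   the decomposition [g = s gamma + r] has no cross term in the form of [Q]. *)
pose r := g - s *: gamma.
have rT : r^T = g^T - s *: gamma^T by rewrite /r linearB linearZ.
have rgam : (r^T *m gamma) 0 0 = 0.
  by rewrite rT mulmxBl -scalemxAl !E00 cc mulr1 subrr.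
have rr : (r^T *m r) 0 0 = 1 - s ^+ 2.
  rewrite {2}/r mulmxBr -scalemxAr !E00 rgam mulr0 subr0.
  by rewrite rT mulmxBl -scalemxAl !E00 gg sC expr2.
have s1 : 0 <= 1 - s ^+ 2 by rewrite -rr sqnormE sumr_ge0// => i _; exact: sqr_ge0.
have gQg : (g^T *m Q *m g) 0 0 <= kappa * s ^+ 2 + beta * (1 - s ^+ 2).
  have -> : (g^T *m Q *m g) 0 0 = kappa * s ^+ 2 + (r^T *m Q *m r) 0 0.
    rewrite {2}/r mulmxBr -scalemxAr -[r^T *m Q *m gamma]mulmxA Qgam -scalemxAr.
    rewrite rT !mulmxBl -!scalemxAl gammaQ -!scalemxAl !E00 cc sC -/s.
    by ring.
  by rewrite lerD2l -rr Qorth.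
have gamQgam : (gamma^T *m Q *m gamma) 0 0 = kappa.
  by rewrite gammaQ -scalemxAl !E00 cc mulr1.
have gSg : (g^T *m S *m g) 0 0 = l by rewrite -mulmxA Sg -scalemxAr !E00 gg mulr1.
have gamSgam : (gamma^T *m S *m gamma) 0 0 <= l.
  by rewrite -[leRHS]mulr1 -cc symmetric_rayleigh_le.
have quadE (A : 'M[R]_k) (v : 'cV[R]_k) :
    (v^T *m A *m v) 0 0 = \sum_i \sum_j A i j * (v i 0 * v j 0).
  rewrite -mulmxA mxE; apply: eq_bigr => i _; rewrite !mxE mulr_sumr.
  by apply: eq_bigr => j _; rewrite mulrCA.
set D := kappa - beta; set N := \sum_i \sum_j _.
have D0 : 0 < D by rewrite subr_gt0.
(* The sum is the inner product of [S - Q] with gg' - gamma gamma'. Maximality of [g] for [S] gives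
   g'Sg >= gamma' S gamma, so it is at least kappa - g'Qg. *)
have gap : D * (1 - s ^+ 2) <=
    \sum_i \sum_j (S i j - Q i j) * (g i 0 * g j 0 - gamma i 0 * gamma j 0).
  have -> : \sum_i \sum_j (S i j - Q i j) * (g i 0 * g j 0 - gamma i 0 * gamma j 0)
      = ((g^T *m S *m g) 0 0 - (g^T *m Q *m g) 0 0)
        - ((gamma^T *m S *m gamma) 0 0 - (gamma^T *m Q *m gamma) 0 0).
    rewrite !quadE -!sumrB; apply: eq_bigr => i _; rewrite -!sumrB.
    by apply: eq_bigr => j _; ring.
  rewrite gamQgam gSg /D; move: gQg gamSgam; lra.
have normdiff : \sum_i \sum_j (g i 0 * g j 0 - gamma i 0 * gamma j 0) ^+ 2
    = 2 - 2 * s ^+ 2.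
  have prodE (u v : 'cV[R]_k) : (u^T *m v) 0 0 ^+ 2
      = \sum_i \sum_j (u i 0 * v i 0) * (u j 0 * v j 0).
    rewrite expr2 mxE mulr_suml; apply: eq_bigr => i _; rewrite mulr_sumr.
    by apply: eq_bigr => j _; rewrite !mxE.
  have -> : 2 - 2 * s ^+ 2 = (g^T *m g) 0 0 ^+ 2 + (gamma^T *m gamma) 0 0 ^+ 2
      - 2 * s ^+ 2 by rewrite gg cc; ring.
  rewrite /s !prodE mulr_sumr -big_split -sumrB; apply: eq_bigr => i _ /=.
  rewrite mulr_sumr -big_split -sumrB; apply: eq_bigr => j _ /=; ring.
(* Termwise x y <= x^2 / D + (D / 4) y^2. The weights make the second sum exactly half of the
   left-hand side, so that it can be absorbed; this produces the constant 4 in [sin2]. *)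
have amgm : D * (1 - s ^+ 2) <= N / D + D / 4 * (2 - 2 * s ^+ 2).
  apply: le_trans gap _.
  rewrite -normdiff /N mulr_suml mulr_sumr -big_split ler_sum// => i _.
  rewrite mulr_suml mulr_sumr -big_split ler_sum// => j _ /=.
  move: (S i j - Q i j) (g i 0 * g j 0 - _) => x y.
  rewrite -subr_ge0.
  have -> : x ^+ 2 / D + D / 4 * y ^+ 2 - x * y = (x - D / 2 * y) ^+ 2 / D.
    by field; rewrite gt_eqF.
  by rewrite divr_ge0 ?sqr_ge0// ltW.
have sin2 : 2 * (1 - s ^+ 2) <= 4 * N / D ^+ 2.
  rewrite ler_pdivlMr ?exprn_gt0//.
  have : D * (D * (1 - s ^+ 2)) <= D * (N / D + D / 4 * (2 - 2 * s ^+ 2)).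
    by rewrite ler_pM2l.
  have -> : D * (N / D + D / 4 * (2 - 2 * s ^+ 2))
      = N + D * (D * (1 - s ^+ 2)) / 2 by field; rewrite gt_eqF.
  rewrite expr2; lra.
apply: le_trans sin2.
have dist c : c ^+ 2 = 1 -> enorm (c *: g - gamma) ^+ 2 = 2 - 2 * (c * s).
  move=> c1; have vT : (c *: g - gamma)^T = c *: g^T - gamma^T.
    by rewrite linearB linearZ.
  rewrite enorm_sqr vT mulmxBl !mulmxBr -!scalemxAl.
  by rewrite -!scalemxAr !E00 gg cc sC -/s mulrA -expr2 c1; ring.
(* The sign of [s] selects the nearer of [g] and [- g], at squared distance 2 - 2|s|, which is at
   most 2 (1 - s^2) because |s| <= 1. *)
rewrite !dist ?expr1n ?sqrrN ?expr1n// mul1r ge_min mulN1r.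
move: s1; rewrite -[s ^+ 2]/(s * s); have [s0|s0] := leP 0 s; first nra.
nra.
Qed.

(** * The weight matrix of S(w) *)

Lemma trmx_lincomb (R : realType) (m n : nat) (a b : R) (A B : 'M[R]_(m, n)) :
  (a *: A + b *: B)^T = a *: A^T + b *: B^T.
Proof. by apply/matrixP => i j; rewrite !mxE. Qed.

Definition weight_mx (R : realType) (n q : nat) (X : 'M[R]_(n, q)) (w : R) : 'M[R]_n :=
  (1 - w) *: hat_mx X + w *: (1%:M - n%:R^-1 *: (ones n *m (ones n)^T) - hat_mx X).

Lemma S_wE (R : realType) (n p q : nat) (X : 'M[R]_(n, q)) (w : R) (Y : 'M[R]_(n, p)) :
  S_w X w Y = Y^T *m weight_mx X w *m Y.
Proof.
by rewrite /weight_mx [in RHS]mulmxDr [in RHS]mulmxDl -!scalemxAr -!scalemxAl.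
Qed.

(** If v X'X = 0 then |v X'|^2 = 0, hence v X' = 0, and full rank forces v = 0. *)
Lemma gram_unitmx (R : realType) (n q : nat) (X : 'M[R]_(n, q)) :
  \rank X = q -> X^T *m X \in unitmx.
Proof.
move=> rX; rewrite -row_free_unit -kermx_eq0; apply/rowV0P => v /sub_kermxP vXX.
have vX : v *m X^T = 0.
  apply/trmx_inj; rewrite trmx0.
  have : ((v *m X^T)^T^T *m (v *m X^T)^T) 0 0 = 0.
    by rewrite trmxK trmx_mul trmxK mulmxA -[v *m X^T *m X]mulmxA vXX mul0mx mxE.
  rewrite sqnormE => /eqP; rewrite psumr_eq0 => [/allP h|i _]; last exact: sqr_ge0.
  apply/matrixP => i j; rewrite [RHS]mxE ord1; apply/eqP; rewrite -sqrf_eq0.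
  exact: h (mem_index_enum i).
have free : row_free X^T by rewrite /row_free mxrank_tr rX.
by apply: (row_free_inj free); rewrite vX mul0mx.
Qed.

Section weight_mx.
Variables (R : realType) (n q : nat) (X : 'M[R]_(n, q)) (w : R).
Hypotheses (n_gt0 : (0 < n)%N) (rX : \rank X = q) (X1 : X^T *m ones n = 0).

Let H := hat_mx X.
Let J : 'M[R]_n := n%:R^-1 *: (ones n *m (ones n)^T).
Let M := weight_mx X w.

Let XXu := gram_unitmx rX.

Let HX : H *m X = X.
Proof. by rewrite /H /hat_mx -!mulmxA mulVmx// mulmx1. Qed.

Let HT : H^T = H.
Proof. by rewrite /H /hat_mx !trmx_mul trmxK trmx_inv trmx_mul trmxK mulmxA. Qed.

Let HH : H *m H = H.
Proof. by rewrite {2}/H /hat_mx !mulmxA HX. Qed.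

Let H1 : H *m ones n = 0.
Proof. by rewrite /H /hat_mx -mulmxA X1 mulmx0. Qed.

Let onesones : (ones n)^T *m ones n = n%:R%:M :> 'M[R]_1.
Proof.
apply/matrixP => i j; rewrite !ord1 !mxE eqxx mulr1n.
by under eq_bigr do rewrite !mxE mulr1; rewrite sumr_const card_ord.
Qed.

Let n_neq0 : n%:R != 0 :> R. Proof. by rewrite pnatr_eq0 -lt0n. Qed.

Let J1 : J *m ones n = ones n.
Proof.
rewrite /J -scalemxAl -mulmxA onesones mul_mx_scalar scalerA mulVf//.
by rewrite scale1r.
Qed.

Let JJ : J *m J = J.
Proof. by rewrite {2}/J -scalemxAr mulmxA J1. Qed.

Let HJ : H *m J = 0.
Proof. by rewrite /J -scalemxAr mulmxA H1 mul0mx scaler0. Qed.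

Let JT : J^T = J.
Proof. by rewrite /J linearZ /= trmx_mul trmxK. Qed.

Let JH : J *m H = 0.
Proof. by rewrite -(trmx0 R n n) -HJ trmx_mul JT HT. Qed.

Let trH : \tr H = q%:R.
Proof. by rewrite /H /hat_mx mxtrace_mulC mulmxA mulmxV// mxtrace1. Qed.

Let trJ : \tr J = 1.
Proof. by rewrite /J mxtraceZ mxtrace_mulC onesones mxtrace_scalar mulr1n mulVf. Qed.

Lemma weight_mx_sym : M^T = M.
Proof. have KT : (1%:M - J - H)^T = 1%:M - J - H by rewrite !linearB /= trmx1 JT HT.
by rewrite /M /weight_mx trmx_lincomb KT HT. Qed.

Lemma weight_mx_ones : M *m ones n = 0.
Proof.
rewrite /M /weight_mx -/H -/J mulmxDl -!scalemxAl !mulmxBl H1 J1 mul1mx.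
by rewrite subrr subr0 !scaler0 addr0.
Qed.

Lemma weight_mx_design : M *m X = (1 - w) *: X.
Proof.
rewrite /M /weight_mx -/H -/J mulmxDl -!scalemxAl !mulmxBl HX mul1mx.
have -> : J *m X = 0.
  apply: trmx_inj; rewrite trmx_mul JT trmx0 /J -scalemxAr mulmxA X1.
  by rewrite mul0mx scaler0.
by rewrite subr0 subrr scaler0 addr0.
Qed.

Lemma mxtrace_weight_mx : \tr M = q%:R + (n%:R - 1 - 2 * q%:R) * w.
Proof.
rewrite /M /weight_mx -/H -/J mxtraceD !mxtraceZ !raddfB /= mxtrace1 trH trJ.
by ring.
Qed.

(** The hat matrix [H] and the residual matrix [K] are projections that annihilate each other, of
    traces q and n - 1 - q. Squaring [M] therefore only squares its two weights. *)
Lemma mxtrace_weight_mx_sqr :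
  \tr (M *m M) = q%:R * (1 - 2 * w) + (n%:R - 1) * w ^+ 2.
Proof.
pose K := 1%:M - J - H.
have HK : H *m K = 0 by rewrite /K !mulmxBr mulmx1 HJ HH subr0 subrr.
have JK : J *m K = 0 by rewrite /K !mulmxBr mulmx1 JH JJ subr0 subrr.
have KH : K *m H = 0 by rewrite /K !mulmxBl mul1mx JH HH subr0 subrr.
have KK : K *m K = K by rewrite {1}/K !mulmxBl mul1mx HK JK !subr0.
have -> : M *m M = (1 - w) ^+ 2 *: H + w ^+ 2 *: K.
  rewrite /M /weight_mx -/H -/J -/K mulmxDl !mulmxDr -!scalemxAl -!scalemxAr.
  by rewrite HK KH HH KK !scaler0 addr0 add0r !scalerA !expr2.
rewrite mxtraceD !mxtraceZ /K !raddfB /= mxtrace1 trH trJ; ring.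
Qed.

End weight_mx.

(** * Gaussian moments *)

Lemma is_derive_normal_pdf (R : realType) (s x : R) : s != 0 ->
  is_derive x 1 (normal_pdf 0 s) (- (x / s ^+ 2) * normal_pdf 0 s x).
Proof.
move=> s0; rewrite normal_pdfE//.
have -> : (fun y => normal_peak s * normal_fun 0 s y) =
    (fun y : R => normal_peak s * expR (- (2 * s ^+ 2)^-1 * y ^+ 2)).
  apply/funext => y; rewrite /normal_fun subr0; congr (_ * expR _).
  by rewrite -mulr_natl mulNr mulrC mulNr.
apply: is_derive_eq.
rewrite /GRing.scale /= /normal_fun subr0.
have -> : - x ^+ 2 / (s ^+ 2 *+ 2) = - (2 * s ^+ 2)^-1 * x ^+ 2.
  by rewrite -mulr_natl mulNr mulrC mulNr.
by move: (expR _) => e; field.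
Qed.

(** With y = x^2 / (2 s^2), the bound e^y >= y^2 / 4 trades the exponential for 16 s^4 / x^4. The
    power 3 is the degree of the boundary term met in the fourth moment. *)
Lemma normal_pdf_decay (R : realType) (s : R) : s != 0 ->
  exists C : R, forall x, 1 <= `|x| -> `|x ^+ 3 * normal_pdf 0 s x| <= C / `|x|.
Proof.
move=> s0; exists (normal_peak s * (16 * s ^+ 4)) => x x1.
have x0 : 0 < `|x| by apply: lt_le_trans x1.
rewrite normal_pdfE// normrM normrX [X in _ * X]ger0_norm; last first.
  by rewrite mulr_ge0 ?normal_peak_ge0 ?normal_fun_ge0.
rewrite mulrCA -[leRHS]mulrA ler_wpM2l ?normal_peak_ge0//.
rewrite /normal_fun subr0 mulNr expRN.
set y := x ^+ 2 / _.
have y0 : 0 < y.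
  by rewrite divr_gt0 ?mulrn_wgt0// ?exprn_even_gt0//= -normr_gt0.
have ey : y ^+ 2 / 4 <= expR y.
  have -> : y = y / 2 + y / 2 by field.
  rewrite expRD; have := expR_ge1Dx (y / 2); have := y0.
  move: (expR _) => e; nra.
apply: (@le_trans _ _ (`|x| ^+ 3 * (y ^+ 2 / 4)^-1)).
  rewrite ler_wpM2l ?exprn_ge0// lef_pV2 ?posrE ?expR_gt0// divr_gt0//.
  by rewrite exprn_gt0.
rewrite le_eqVlt; apply/orP; left; apply/eqP.
rewrite /y -[x ^+ 2]real_normK ?num_real// -mulr_natl; field.
by rewrite s0 gt_eqF.
Qed.

(** Integration by parts with the antiderivative given in advance: on [-n, n] the integral of [f]
    against the density differs from [k] times the mass by a boundary term that tends to 0. Since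
    [f] is nonnegative, monotone convergence carries this to the whole line. *)
Lemma integral_mul_normal_pdf (R : realType) (s : R) (f F : R -> R) (k : R) :
  s != 0 -> (forall x, 0 <= f x) -> continuous f ->
  (forall x : R, is_derive x 1 F ((f x - k) * normal_pdf 0 s x)) ->
  F n%:R - F (- n%:R) @[n --> \oo] --> 0 ->
  (\int[lebesgue_measure]_x (f x * normal_pdf 0 s x)%:E = k%:E)%E.
Proof.
move=> s0 f0 cf dF F0.
pose I (n : nat) : set R := `[- n%:R, n%:R]%classic.
have mI n : measurable (I n) by exact: measurable_itv.
have ndI : nondecreasing_seq I.
  move=> m n mn; apply/subsetPset => x; rewrite /I /= !in_itv/= => /andP[mx xm].
  have mnR : (m%:R : R) <= n%:R by rewrite ler_nat.
  by rewrite (le_trans _ mx) ?lerN2//= (le_trans xm).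
have UI : \bigcup_n I n = setT.
  apply/seteqP; split=> // x _; exists (Num.trunc `|x|).+1 => //.
  rewrite /I /= in_itv /= -ler_norml; apply/ltW/Num.Theory.truncnS_gt.
have cpdf : continuous (normal_pdf 0 s) by exact: continuous_normal_pdf.
have cvgI (g : R -> R) : (forall x, 0 <= g x) -> continuous g ->
    (\int[lebesgue_measure]_(x in I n) (g x)%:E @[n --> \oo] -->
     \int[lebesgue_measure]_x (g x)%:E)%E.
  move=> g0 cg; rewrite -UI; apply: ge0_nondecreasing_set_cvg_integral => //.
  - move=> n; apply/measurable_EFinP; apply: measurable_funTS.
    exact: continuous_measurable_fun.
  - by move=> n x _; rewrite lee_fin.
have cfp : continuous (fun x => f x * normal_pdf 0 s x).
  by move=> x; apply: cvgM; [exact: cf|exact: cpdf].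
have h1 := cvgI _ (fun x => mulr_ge0 (f0 x) (normal_pdf_ge0 0 s x)) cfp.
have h2 := cvgI _ (normal_pdf_ge0 0 s) cpdf.
have intpdf n : lebesgue_measure.-integrable (I n) (EFin \o normal_pdf 0 s).
  have := integrable_normal_pdf 0 s.
  exact: (@integrableS _ _ R lebesgue_measure setT (I n) (EFin \o normal_pdf 0 s) measurableT (mI n) (@subsetT _ _)).
have intfp n : lebesgue_measure.-integrable (I n)
    (EFin \o (fun x => f x * normal_pdf 0 s x)).
  apply: continuous_compact_integrable; first exact: segment_compact.
  exact: continuous_subspaceT.
have FTC n : (0 < n)%N ->
    (\int[lebesgue_measure]_(x in I n) (f x * normal_pdf 0 s x)%:E =
     (F n%:R - F (- n%:R))%:E +
     k%:E * \int[lebesgue_measure]_(x in I n) (normal_pdf 0 s x)%:E)%E.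
  move=> n0; rewrite -integralZl//; last exact: mI.
  have n0R : - n%:R < n%:R :> R by rewrite gtrN// ltr0n.
  have cF x : {for x, continuous F}.
    by apply: differentiable_continuous; apply/derivable1_diffP; exact: ex_derive.
  rewrite EFinB -(@continuous_FTC2 _ (fun x => (f x - k) * normal_pdf 0 s x) F)//.
  - rewrite -integralD//=.
    + by apply: eq_integral => x _; rewrite -EFinM -EFinD; congr EFin; ring.
    + apply: continuous_compact_integrable; first exact: segment_compact.
      apply: continuous_subspaceT => x; apply: cvgM; last exact: cpdf.
      by apply: cvgB; [exact: cf|exact: cvg_cst].
    + by apply: integrableZl => //; exact: intpdf.
  - apply: continuous_subspaceT => x; apply: cvgM; last exact: cpdf.
    by apply: cvgB; [exact: cf|exact: cvg_cst].
  - split; first by move=> x _; exact: ex_derive.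
      by apply: cvg_at_right_filter; exact: cF.
    by apply: cvg_at_left_filter; exact: cF.
  - by move=> x _; rewrite derive1E; exact: derive_val.
have h3 : ((F n%:R - F (- n%:R))%:E +
     k%:E * \int[lebesgue_measure]_(x in I n) (normal_pdf 0 s x)%:E
     @[n --> \oo] --> 0%:E + k%:E * 1)%E.
  apply: cvgeD; [by []| |].
    by apply: cvg_EFin; [exact: nearW|].
  apply: cvgeZl => //.
  by rewrite -(integral_normal_pdf 0 s).
have h4 : (\int[lebesgue_measure]_(x in I n) (f x * normal_pdf 0 s x)%:E
     @[n --> \oo] --> 0%:E + k%:E * 1)%E.
  apply: cvg_trans h3; apply: near_eq_cvg; near=> m; apply/esym/FTC.
  by near: m; exact: nbhs_infty_gt.
by rewrite -(cvg_lim _ h1)// (cvg_lim _ h4)// add0e mule1.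
Unshelve. all: by end_near. Qed.

(** The Radon-Nikodym derivative of [normal_prob] and [normal_pdf] have the same integral over every
    measurable set, hence agree almost everywhere. *)
Lemma ge0_integral_normal_prob (R : realType) (m s : R) (f : R -> \bar R) :
  (forall x, 0 <= f x)%E -> measurable_fun setT f ->
  (\int[normal_prob m s]_x f x =
   \int[lebesgue_measure]_x (f x * (normal_pdf m s x)%:E))%E.
Proof.
move=> f0 mf; have dom := normal_prob_dominates m s.
rewrite -(Radon_Nikodym_SigmaFinite.change_of_variables dom)//=.
have irn := @Radon_Nikodym_SigmaFinite.f_integrable _ _ R (normal_prob m s)
  lebesgue_measure dom.
apply: ae_eq_integral => //.
- apply: emeasurable_funM => //; exact: measurable_int irn.
- apply: emeasurable_funM => //; apply/measurable_EFinP.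
  exact: measurable_normal_pdf.
- apply: ae_eqe_mul2l; apply: integral_ae_eq => //.
  + by apply/measurable_EFinP; exact: measurable_normal_pdf.
  + by move=> E _ mE; rewrite -Radon_Nikodym_SigmaFinite.f_integral.
Qed.

Lemma cvg_subN0 (R : realType) (G : R -> R) (K : R) :
  (forall x, 1 <= `|x| -> `|G x| <= K / `|x|) ->
  G n%:R - G (- n%:R) @[n --> \oo] --> 0.
Proof.
move=> GK; apply/cvgr0Pnorm_le => e e0; near=> n.
have n1 : (0 < n)%N by near: n; exact: nbhs_infty_gt.
have nR : 0 < n%:R :> R by rewrite ltr0n.
have n1R : (1 : R) <= `|n%:R| by rewrite ger0_norm// ler1n.
have h1 := GK n%:R n1R.
have h2 : `|G (- n%:R)| <= K / `|n%:R : R|.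
  by rewrite -(normrN n%:R); apply: GK; rewrite normrN.
apply: le_trans (ler_normB _ _) _; apply: le_trans (lerD h1 h2) _.
rewrite -mulrDl ger0_norm// ler_pdivrMr// mulrC -ler_pdivrMr//.
by near: n; exact: nbhs_infty_ger.
Unshelve. all: by end_near. Qed.

Lemma cvg_mul_normal_pdf_subN0 (R : realType) (s : R) (G : R -> R) (K : R) :
  s != 0 -> 0 <= K -> (forall x, 1 <= `|x| -> `|G x| <= K * `|x ^+ 3|) ->
  G n%:R * normal_pdf 0 s n%:R - G (- n%:R) * normal_pdf 0 s (- n%:R)
    @[n --> \oo] --> 0.
Proof.
move=> s0 K0 GK; have [C Cle] := normal_pdf_decay s0.
apply: (@cvg_subN0 R (fun x => G x * normal_pdf 0 s x) (K * C)) => x x1.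
rewrite normrM; apply: (@le_trans _ _ (K * `|x ^+ 3 * normal_pdf 0 s x|)).
  by rewrite normrM mulrA ler_wpM2r// GK.
by rewrite -(mulrA K) ler_wpM2l// Cle.
Qed.

Lemma normal_prob_moment2 (R : realType) (s : R) : s != 0 ->
  (\int[normal_prob 0 s]_x (x ^+ 2)%:E = (s ^+ 2)%:E)%E.
Proof.
move=> s0; rewrite ge0_integral_normal_prob; last 2 first.
- by move=> x; rewrite lee_fin sqr_ge0.
- by apply/measurable_EFinP; exact: measurable_funX.
under eq_integral do rewrite -EFinM.
(* Writing f for the density, f' = - (x / s^2) f, so that (- s^2 x f)' = (x^2 - s^2) f. *)
apply: (@integral_mul_normal_pdf R s _
  (fun x => (- s ^+ 2 * x) * normal_pdf 0 s x)) => //.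
- by move=> x; exact: sqr_ge0.
- by move=> x; exact: exprn_continuous.
- move=> x; have dpdf := is_derive_normal_pdf x s0.
  apply: is_derive_eq; rewrite /GRing.scale /=; field; exact: s0.
- apply: (@cvg_mul_normal_pdf_subN0 R s (fun x => - s ^+ 2 * x) (s ^+ 2)) => //.
    exact: sqr_ge0.
  move=> x x1; rewrite normrM normrN [`|s ^+ 2|]ger0_norm ?sqr_ge0//.
  by rewrite ler_wpM2l ?sqr_ge0// normrX exprS ler_peMr// exprn_ege1.
Qed.

Lemma normal_prob_moment4 (R : realType) (s : R) : s != 0 ->
  (\int[normal_prob 0 s]_x (x ^+ 4)%:E = (3 * s ^+ 4)%:E)%E.
Proof.
move=> s0; have s2 : 0 <= 3 * s ^+ 2 by rewrite mulr_ge0// sqr_ge0.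
have s2' : 0 <= 1 + 3 * s ^+ 2 by rewrite addr_ge0.
have x4 (x : R) : 0 <= x ^+ 4 by rewrite exprn_even_ge0.
rewrite ge0_integral_normal_prob; last 2 first.
- by move=> x; rewrite lee_fin.
- by apply/measurable_EFinP; exact: measurable_funX.
under eq_integral do rewrite -EFinM.
(* The cubic is chosen so that the x^2 terms of the derivative cancel, which leaves (x^4 - 3 s^4)
   times the density. *)
apply: (@integral_mul_normal_pdf R s (fun x => x ^+ 4)
  (fun x => (- s ^+ 2 * (x ^+ 3 + 3 * s ^+ 2 * x)) * normal_pdf 0 s x)
  (3 * s ^+ 4)) => [//|//| | |].
- by move=> x; exact: exprn_continuous.
- move=> x; have dpdf := is_derive_normal_pdf x s0.
  apply: is_derive_eq; rewrite /GRing.scale /=; field; exact: s0.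
- apply: (@cvg_mul_normal_pdf_subN0 R s
    (fun x => - s ^+ 2 * (x ^+ 3 + 3 * s ^+ 2 * x))
    (s ^+ 2 * (1 + 3 * s ^+ 2))) => //.
    by rewrite mulr_ge0 ?sqr_ge0.
  move=> x x1; rewrite normrM normrN [`|s ^+ 2|]ger0_norm ?sqr_ge0//.
  rewrite -(mulrA (s ^+ 2)) ler_wpM2l ?sqr_ge0//.
  apply: le_trans (ler_normD _ _) _; rewrite [leRHS]mulrDl mul1r lerD2l.
  rewrite normrM [`|3 * s ^+ 2|]ger0_norm// ler_wpM2l//.
  by rewrite normrX exprS ler_peMr// exprn_ege1.
Qed.

(** Integrability travels with the value because additivity of the integral requires it. The pair is
    stable under linear combinations, so the mean of a polynomial in the entries of [E] follows the
    algebraic expression term by term. *)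
Definition has_mean (R : realType) (d : measure_display) (T : measurableType d)
    (P : probability T R) (f : T -> R) (v : R) : Prop :=
  P.-integrable setT (EFin \o f) /\ (\int[P]_x (f x)%:E = v%:E)%E.

Section has_mean.
Variables (R : realType) (d : measure_display) (T : measurableType d).
Variable P : probability T R.
Implicit Types (f g : T -> R) (u v c : R).

Lemma has_mean_ext f g u v : has_mean P f u -> f =1 g -> u = v -> has_mean P g v.
Proof. by move=> + /funext <- <-. Qed.

Lemma has_mean_cst c : has_mean P (fun=> c) c.
Proof.
split; last by rewrite integral_cst// [X in (_ * X)%E]probability_setT mule1.
exact: (@finite_measure_integrable_cst _ _ _ P).
Qed.

Lemma has_meanD f g u v : has_mean P f u -> has_mean P g v ->
  has_mean P (fun x => f x + g x) (u + v).
Proof.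
move=> [fi fu] [gi gv]; split.
  by rewrite (_ : EFin \o _ = (EFin \o f) \+ (EFin \o g))%E//; exact: integrableD.
under eq_integral do rewrite EFinD.
by rewrite integralD//= fu gv.
Qed.

Lemma has_meanZ c f u : has_mean P f u -> has_mean P (fun x => c * f x) (c * u).
Proof.
move=> [fi fu]; split.
  by rewrite (_ : EFin \o _ = (fun x => c%:E * (f x)%:E))%E//; exact: integrableZl.
under eq_integral do rewrite EFinM.
by rewrite integralZl// fu.
Qed.

Lemma has_mean_sum (I : Type) (r : seq I) (f : I -> T -> R) (u : I -> R) :
  (forall i, has_mean P (f i) (u i)) ->
  has_mean P (fun x => \sum_(i <- r) f i x) (\sum_(i <- r) u i).
Proof.
move=> fu; elim: r => [|i r IHr].
  apply: (has_mean_ext (has_mean_cst 0)); last by rewrite big_nil.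
  by move=> x; rewrite big_nil.
apply: (has_mean_ext (has_meanD (fu i) IHr)); last by rewrite big_cons.
by move=> x; rewrite big_cons.
Qed.

Lemma has_mean_ge0 f v : measurable_fun setT f -> (forall x, 0 <= f x) ->
  (\int[P]_x (f x)%:E = v%:E)%E -> has_mean P f v.
Proof.
move=> mf f0 fv; split=> //; apply/integrableP; split; first exact/measurable_EFinP.
under eq_integral do rewrite /= ger0_norm//.
by rewrite fv ltry.
Qed.

(** Equality of the laws of [W] and [- W] makes the integral equal to its own opposite;
    integrability makes it finite, hence 0. *)
Lemma has_mean_odd (W : T -> R) (h : R -> R) :
  measurable_fun setT W -> measurable_fun setT h ->
  (forall y, h (- y) = - h y) ->
  (forall A : set R, measurable A ->
     pushforward P W A = pushforward P (fun x => - W x) A) ->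
  P.-integrable setT (EFin \o (h \o W)) -> has_mean P (h \o W) 0.
Proof.
move=> mW mh hodd sym hi; split=> //.
have mNW : measurable_fun setT (fun x => - W x) by exact: measurableT_comp.
have hNi : P.-integrable setT (EFin \o (h \o (fun x => - W x))).
  rewrite (_ : EFin \o _ = (fun x => (-1)%:E * (h (W x))%:E))%E; last first.
    by apply/funext => x /=; rewrite hodd mulN1e.
  exact: integrableZl.
have mEh : measurable_fun setT (EFin \o h) by exact/measurable_EFinP.
have e1 := integral_pushforward mW mEh hi measurableT.
have e2 := integral_pushforward mNW mEh hNi measurableT.
have e3 : (\int[pushforward P W]_y (EFin \o h) y =
    \int[pushforward P (fun x => - W x)%R]_y (EFin \o h) y)%E.
  by apply: eq_measure_integral => A mA _; exact: sym.
move: e3; rewrite e1 e2 !preimage_setT /=.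
have fin := integrable_fin_num measurableT hi.
under [X in _ = X -> _]eq_integral do rewrite /= hodd EFinN.
rewrite integralN; last exact: integrable_add_def hi.
move: fin; rewrite /=; case: (\int[P]_x _)%E => [r _| |]//.
rewrite -EFinN => -[] /eqP; rewrite -addr_eq0 -mulr2n mulrn_eq0 /= => /eqP ->.
by [].
Qed.

End has_mean.

(** * Mixed moments of a Gaussian vector *)

Section gaussian_moments.
Variables (R : realType) (d : measure_display) (T : measurableType d).
Variables (P : probability T R) (k : nat) (Z : T -> 'cV[R]_k) (V : 'M[R]_k).
Hypotheses (hZ : mvnormal P Z 0 V) (VT : V^T = V).
Hypothesis V_ge0 : forall t : 'cV[R]_k, 0 <= (t^T *m V *m t) 0 0.

Let W (t : 'cV[R]_k) (x : T) : R := (t^T *m Z x) 0 0.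
Let B (s t : 'cV[R]_k) : R := (s^T *m V *m t) 0 0.

Let measurable_W t : measurable_fun setT (W t).
Proof.
have [mZ _] := hZ.
have -> : W t = fun x => \sum_j t j 0 * Z x j 0.
  by apply/funext => x; rewrite /W mxE; apply: eq_bigr => j _; rewrite mxE.
by apply: measurable_sum => j; exact: measurable_funM.
Qed.

Let WD s t x : W (s + t) x = W s x + W t x.
Proof. by rewrite /W linearD /= mulmxDl mxE. Qed.

Let WN t x : W (- t) x = - W t x.
Proof. by rewrite /W linearN /= mulNmx mxE. Qed.

Let BDl s t u : B (s + t) u = B s u + B t u.
Proof. by rewrite /B linearD /= !mulmxDl mxE. Qed.

Let BDr s t u : B u (s + t) = B u s + B u t.
Proof. by rewrite /B mulmxDr mxE. Qed.

Let BC s t : B s t = B t s.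
Proof. by rewrite /B -[in LHS](trmxK (s^T *m V *m t)) [LHS]mxE !trmx_mul trmxK VT mulmxA. Qed.

Let BNN t : B (- t) (- t) = B t t.
Proof.
have NT : (- t)^T = - t^T by rewrite linearN.
by rewrite /B NT !mulNmx mulmxN opprK.
Qed.

Let lawW t (A : set R) : measurable A -> pushforward P (W t) A = normal_law 0 (B t t) A.
Proof. by move=> mA; have [_ /(_ t A mA)] := hZ; rewrite mulmx0 mxE. Qed.

(** Orders 2 and 4 share this reduction, with [c] equal to 1 and 3. A form of variance 0 is settled
    here once: its law is the Dirac mass at 0, and both sides vanish because [m] is positive. *)
Let moment_even t m (c : R) : ~~ odd m -> (0 < m)%N ->
  (B t t != 0 ->
   (\int[normal_prob 0 (Num.sqrt (B t t))]_y (y ^+ m)%:E = (c * (B t t) ^+ m./2)%:E)%E) ->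
  has_mean P (fun x => W t x ^+ m) (c * (B t t) ^+ m./2).
Proof.
move=> evm m0 hm; have ym0 (y : R) : 0 <= y ^+ m by exact: exprn_even_ge0.
(* The measurableType of normal_prob is measurableTypeR R, not the default one
   of R, although their measurable sets are the same. *)
pose W' : T -> measurableTypeR R := W t.
have mW' : measurable_fun setT W' := measurable_W t.
have mp : measurable_fun setT (fun y : measurableTypeR R => ((y : R) ^+ m)%:E).
  by apply/measurable_EFinP; exact: measurable_funX.
apply: has_mean_ge0 => //; first exact: measurable_funX.
transitivity (\int[pushforward P W']_y ((y : R) ^+ m)%:E)%E.
  rewrite (ge0_integral_pushforward mW' P measurableT mp) ?preimage_setT//.
  by move=> y _; rewrite lee_fin.
have [B0|B0] := eqVneq (B t t) 0.
  transitivity (\int[\d_ (0%R : measurableTypeR R)]_y ((y : R) ^+ m)%:E)%E.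
    apply: eq_measure_integral => A mA _; have := lawW t mA.
    by rewrite /normal_law B0 eqxx.
  rewrite integral_dirac// diracT mul1e expr0n B0 expr0n.
  have -> : (m./2 == 0)%N = false by case: m evm m0 {hm ym0 mp} => [|[|]].
  by rewrite mulr0 gtn_eqF.
rewrite -hm//; apply: eq_measure_integral => A mA _; have := lawW t mA.
by rewrite /normal_law (negbTE B0).
Qed.

Let moment2 t : has_mean P (fun x => W t x ^+ 2) (B t t).
Proof.
rewrite -[B t t]mul1r -[X in 1 * X]expr1; apply: moment_even => // B0.
have B1 : 0 < B t t by rewrite lt0r B0 V_ge0.
rewrite normal_prob_moment2 ?gt_eqF ?sqrtr_gt0//.
by rewrite sqr_sqrtr ?ltW// mul1r expr1.
Qed.

Let moment4 t : has_mean P (fun x => W t x ^+ 4) (3 * B t t ^+ 2).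
Proof.
apply: (@moment_even t 4) => // B0.
have B1 : 0 < B t t by rewrite lt0r B0 V_ge0.
rewrite normal_prob_moment4 ?gt_eqF ?sqrtr_gt0//.
by rewrite -[4%N]/(2 * 2)%N exprM sqr_sqrtr ?ltW.
Qed.

Let moment_odd t m : odd m -> (m <= 4)%N -> has_mean P (fun x => W t x ^+ m) 0.
Proof.
move=> om m4; apply: (@has_mean_odd _ _ _ P (W t) (fun y => y ^+ m)) => //.
- by move=> y; rewrite exprNn -signr_odd om expr1 mulN1r.
- move=> A mA; rewrite lawW//.
  have -> : (fun x => - W t x) = W (- t) by apply/funext => x; rewrite WN.
  by rewrite (lawW _ mA) BNN.
(* Integrability comes from |y|^m <= 1 + y^4, valid for m <= 4. *)
have [i4 _] := has_meanD (has_mean_cst P 1) (moment4 t).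
apply: le_integrable i4 => //.
  by apply/measurable_EFinP; apply: measurable_funX.
move=> x _; rewrite /= lee_fin normrX.
rewrite [leRHS]ger0_norm ?addr_ge0 ?exprn_even_ge0//.
have -> : W t x ^+ 4 = `|W t x| ^+ 4 by rewrite -normrX ger0_norm ?exprn_even_ge0.
have [w1|w1] := leP `|W t x| 1.
  by rewrite (@le_trans _ _ 1) ?exprn_ile1// lerDl exprn_ge0.
by rewrite (@le_trans _ _ (`|W t x| ^+ 4)) ?lerDr// ler_weXn2l// ltW.
Qed.

Let moment3 t : has_mean P (fun x => W t x ^+ 3) 0.
Proof. exact: moment_odd. Qed.

Lemma gaussian_mean1 (s : 'cV[R]_k) : has_mean P (fun x => (s^T *m Z x) 0 0) 0.
Proof.
have h := @moment_odd s 1 isT isT.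
by apply: (has_mean_ext h) => [x|//]; rewrite expr1.
Qed.

Lemma gaussian_mean2 (s t : 'cV[R]_k) :
  has_mean P (fun x => (s^T *m Z x) 0 0 * (t^T *m Z x) 0 0) ((s^T *m V *m t) 0 0).
Proof.
have h := has_meanZ (1 / 2) (has_meanD (moment2 (s + t))
  (has_meanD (has_meanZ (-1) (moment2 s)) (has_meanZ (-1) (moment2 t)))).
apply: (has_mean_ext h) => [x|]; rewrite -?/(W _ _) -?/(B _ _).
  by rewrite !WD; field.
by rewrite !BDl !BDr (BC t s); field.
Qed.

(** Polarisation of the cube: 6 xyz is the alternating sum of the cubes of all partial sums of x, y,
    z, and each of these cubes has mean 0. *)
Lemma gaussian_mean3 (s t u : 'cV[R]_k) :
  has_mean P (fun x => (s^T *m Z x) 0 0 * (t^T *m Z x) 0 0 * (u^T *m Z x) 0 0) 0.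
Proof.
have h := has_meanZ (1 / 6) (has_meanD (moment3 (s + t + u))
  (has_meanD (has_meanZ (-1) (has_meanD (moment3 (s + t))
    (has_meanD (moment3 (s + u)) (moment3 (t + u)))))
  (has_meanD (moment3 s) (has_meanD (moment3 t) (moment3 u))))).
apply: (has_mean_ext h) => [x|]; rewrite -?/(W _ _).
  by rewrite !WD; field.
by ring.
Qed.

(* Isserlis' formula, by polarising the fourth moment. *)
Lemma gaussian_mean4 (r s t u : 'cV[R]_k) :
  has_mean P (fun x => (r^T *m Z x) 0 0 * (s^T *m Z x) 0 0
                       * ((t^T *m Z x) 0 0 * (u^T *m Z x) 0 0))
    ((r^T *m V *m s) 0 0 * (t^T *m V *m u) 0 0
     + (r^T *m V *m t) 0 0 * (s^T *m V *m u) 0 0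
     + (r^T *m V *m u) 0 0 * (s^T *m V *m t) 0 0).
Proof.
(* 24 times the product of four numbers is the sum of the fourth powers of all their nonempty
   partial sums, signed by the parity of the number of terms. *)
have h := has_meanZ (1 / 24) (has_meanD
  (has_meanD (moment4 (r + s + t + u))
    (has_meanZ (-1) (has_meanD (has_meanD (moment4 (r + s + t)) (moment4 (r + s + u)))
                      (has_meanD (moment4 (r + t + u)) (moment4 (s + t + u))))))
  (has_meanD
    (has_meanD (has_meanD (moment4 (r + s)) (moment4 (r + t)))
      (has_meanD (has_meanD (moment4 (r + u)) (moment4 (s + t)))
        (has_meanD (moment4 (s + u)) (moment4 (t + u)))))
    (has_meanZ (-1) (has_meanD (has_meanD (moment4 r) (moment4 s))
                      (has_meanD (moment4 t) (moment4 u)))))).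
apply: (has_mean_ext h) => [x|]; rewrite -?/(W _ _) -?/(B _ _).
  by rewrite !WD; field.
rewrite !BDl !BDr (BC s r) (BC t r) (BC u r) (BC t s) (BC u s) (BC u t).
by field.
Qed.

End gaussian_moments.

(** * Moments of a Gaussian matrix with independent rows *)

Lemma sum_mulr_delta (R : realType) (n : nat) (F : 'I_n -> R) (i : 'I_n) :
  \sum_k F k * (i == k)%:R = F i.
Proof.
rewrite (bigD1 i)//= eqxx mulr1 big1 ?addr0// => k ki.
by rewrite eq_sym (negbTE ki) mulr0.
Qed.

(** These are the three pairings of Isserlis' formula contracted with two copies of [M]. Pairing
    within each copy gives the squared trace; the two pairings across the copies give tr M^2, by
    symmetry of [M]. In use, [a] and [a'] are [Sigma j l] and [Sigma l j], while [b] and [c] are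
    diagonal entries of [Sigma]. *)
Lemma sum4_pairings (R : realType) (n : nat) (M : 'M[R]_n) (a a' b c : R) :
  M^T = M ->
  \sum_i \sum_k \sum_i' \sum_k' (M i k * M i' k') *
    (a * (i == k)%:R * (a * (i' == k')%:R)
     + b * (i == i')%:R * (c * (k == k')%:R)
     + a * (i == k')%:R * (a' * (k == i')%:R))
  = a ^+ 2 * (\tr M) ^+ 2 + (b * c + a * a') * \tr (M *m M).
Proof.
move=> MT; have Ms i k : M k i = M i k by rewrite -[in LHS]MT mxE.
transitivity (\sum_i \sum_k M i k *
    (a ^+ 2 * \tr M * (i == k)%:R + (b * c + a * a') * M i k)).
  apply: eq_bigr => i _; apply: eq_bigr => k _.
  transitivity (\sum_i' M i k * (a ^+ 2 * (i == k)%:R * M i' i'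
      + (b * c * M i' k) * (i == i')%:R + (a * a' * M i' i) * (k == i')%:R)).
    apply: eq_bigr => i' _.
    rewrite (eq_bigr (fun k' => (M i k * (a ^+ 2 * (i == k)%:R) * M i' k') * (i' == k')%:R
      + (M i k * (b * c * (i == i')%:R) * M i' k') * (k == k')%:R
      + (M i k * (a * a' * (k == i')%:R) * M i' k') * (i == k')%:R)); last first.
      by move=> k' _; ring.
    rewrite !big_split /= !sum_mulr_delta; ring.
  rewrite -mulr_sumr !big_split /= !sum_mulr_delta -mulr_sumr -/(\tr M) (Ms i k).
  by congr (_ * _); ring.
rewrite (eq_bigr (fun i => a ^+ 2 * \tr M * M i i
    + (b * c + a * a') * \sum_k M i k * M k i)).
  rewrite big_split /= -!mulr_sumr -/(\tr M) -mulrA -expr2; congr (_ + _ * _).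
  by rewrite /mxtrace; apply: eq_bigr => i _; rewrite mxE.
move=> i _; rewrite -[in RHS](sum_mulr_delta (fun k => M i k) i) !mulr_sumr -big_split.
by apply: eq_bigr => k _ /=; rewrite (Ms i k); ring.
Qed.

Section matrix_gaussian_moments.
Variables (R : realType) (d : measure_display) (T : measurableType d).
Variables (P : probability T R) (n p : nat) (Sigma : 'M[R]_p).
Variable E : T -> 'M[R]_(n, p).
Hypotheses (hSigma : posdef Sigma).
Hypothesis hE : mvnormal P (fun x => vec (E x)) 0 (Sigma *t 1%:M).

Let V : 'M[R]_(p * n) := Sigma *t 1%:M.

Let SigmaC j l : Sigma j l = Sigma l j.
Proof. by have [ST _] := hSigma; rewrite -[in LHS]ST mxE. Qed.

Let VT : V^T = V.
Proof. by rewrite /V trmx_tens trmx1; have [-> _] := hSigma. Qed.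

Let posdef_ge0 (v : 'cV[R]_p) : 0 <= (v^T *m Sigma *m v) 0 0.
Proof.
have [->|v0] := eqVneq v 0; first by rewrite mulmx0 mxE.
by have [_ /(_ v v0)/ltW] := hSigma.
Qed.

(** Cutting [t] into [n] vectors of length [p], one per row of [E], makes the Kronecker form a sum
    of [n] forms of [Sigma]. *)
Let V_ge0 (t : 'cV[R]_(p * n)) : 0 <= (t^T *m V *m t) 0 0.
Proof.
pose c (i : 'I_n) : 'cV[R]_p := \col_j t (mxtens_index (j, i)) 0.
suff -> : (t^T *m V *m t) 0 0 = \sum_i ((c i)^T *m Sigma *m c i) 0 0.
  by apply: sumr_ge0.
have tensE (F : 'I_(p * n) -> R) :
    \sum_k F k = \sum_j \sum_i F (mxtens_index (j, i)).
  rewrite pair_bigA /=; rewrite (reindex (@mxtens_index p n)).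
    by apply: eq_bigr => -[].
  by exists (@mxtens_unindex p n) => ? _; rewrite (mxtens_indexK, mxtens_unindexK).
rewrite mxE tensE exchange_big; apply: eq_bigr => i _ /=.
rewrite mxE; apply: eq_bigr => j _; rewrite [in RHS]mxE.
congr (_ * _); last by rewrite mxE.
rewrite !mxE tensE; apply: eq_bigr => l _.
rewrite -[RHS](sum_mulr_delta (fun i' => (c i')^T 0 l * Sigma l j) i).
by apply: eq_bigr => i' _; rewrite tensmxE !mxE eq_sym mulrA.
Qed.

Let del i j : 'cV[R]_(p * n) := delta_mx (mxtens_index (j, i)) 0.

Let delE i j x : ((del i j)^T *m vec (E x)) 0 0 = E x i j.
Proof. by rewrite /del trmx_delta -rowE !mxE mxtens_indexK. Qed.

Let delV i j k l : ((del i j)^T *m V *m del k l) 0 0 = Sigma j l * (i == k)%:R.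
Proof. by rewrite /del trmx_delta -rowE -colE !mxE !mxtens_indexK. Qed.

Let mean1 i j : has_mean P (fun x => E x i j) 0.
Proof.
apply: (has_mean_ext (gaussian_mean1 hE V_ge0 (del i j))) => [x|//].
exact: delE.
Qed.

Let mean2 i j k l :
  has_mean P (fun x => E x i j * E x k l) (Sigma j l * (i == k)%:R).
Proof.
apply: (has_mean_ext (gaussian_mean2 hE VT V_ge0 (del i j) (del k l))) => [x|].
  by rewrite !delE.
exact: delV.
Qed.

Let mean3 i j k l i' j' : has_mean P (fun x => E x i j * E x k l * E x i' j') 0.
Proof.
apply: (has_mean_ext (gaussian_mean3 hE V_ge0 (del i j) (del k l) (del i' j'))) => [x|//].
by rewrite !delE.
Qed.

Let mean4 i j k l i' j' k' l' :
  has_mean P (fun x => E x i j * E x k l * (E x i' j' * E x k' l'))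
   (Sigma j l * (i == k)%:R * (Sigma j' l' * (i' == k')%:R)
    + Sigma j j' * (i == i')%:R * (Sigma l l' * (k == k')%:R)
    + Sigma j l' * (i == k')%:R * (Sigma l j' * (k == i')%:R)).
Proof.
apply: (has_mean_ext (gaussian_mean4 hE VT V_ge0 (del i j) (del k l) (del i' j') (del k' l'))) => [x|].
  by rewrite !delE.
by rewrite !delV.
Qed.

Section second_moment.
Variables (M : 'M[R]_n) (u : 'cV[R]_n) (gamma : 'cV[R]_p) (kappa : R).
Hypothesis MT : M^T = M.

(** Entry (j, l) of E'ME, not of the mean matrix of S(w); [z] below is E'u. *)
Let Q x j l := \sum_i \sum_k M i k * (E x i j * E x k l).
Let z x l := \sum_i u i 0 * E x i l.

Let mean_Q j l : has_mean P (fun x => Q x j l) (\tr M * Sigma j l).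
Proof.
apply: (has_mean_ext (has_mean_sum (index_enum 'I_n) (fun i =>
  has_mean_sum (index_enum 'I_n) (fun k => has_meanZ (M i k) (mean2 i j k l))))) => //.
rewrite /mxtrace mulr_suml; apply: eq_bigr => i _.
rewrite -(sum_mulr_delta (fun k => M i k * Sigma j l)).
by apply: eq_bigr => k _; rewrite mulrA.
Qed.

Let mean_QQ j l : has_mean P (fun x => Q x j l ^+ 2)
  (Sigma j l ^+ 2 * (\tr M) ^+ 2
   + (Sigma j j * Sigma l l + Sigma j l ^+ 2) * \tr (M *m M)).
Proof.
apply: (has_mean_ext (has_mean_sum (index_enum 'I_n) (fun i =>
  has_mean_sum (index_enum 'I_n) (fun k =>
  has_mean_sum (index_enum 'I_n) (fun i' =>
  has_mean_sum (index_enum 'I_n) (fun k' =>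
    has_meanZ (M i k * M i' k') (mean4 i j k l i' j k' l))))))) => [x|].
  rewrite expr2 /Q mulr_suml; apply: eq_bigr => i _.
  rewrite mulr_suml; apply: eq_bigr => k _.
  rewrite mulr_sumr; apply: eq_bigr => i' _.
  by rewrite mulr_sumr; apply: eq_bigr => k' _; rewrite mulrACA.
by rewrite sum4_pairings// (SigmaC l j) -expr2.
Qed.

Let mean_z l : has_mean P (fun x => z x l) 0.
Proof.
apply: (has_mean_ext (has_mean_sum (index_enum 'I_n) (fun i =>
  has_meanZ (u i 0) (mean1 i l)))) => //.
by rewrite big1// => i _; rewrite mulr0.
Qed.

Let mean_zz l m : has_mean P (fun x => z x l * z x m)
  ((u^T *m u) 0 0 * Sigma l m).
Proof.
apply: (has_mean_ext (has_mean_sum (index_enum 'I_n) (fun i =>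
  has_mean_sum (index_enum 'I_n) (fun k =>
    has_meanZ (u i 0 * u k 0) (mean2 i l k m))))) => [x|].
  rewrite /z mulr_suml; apply: eq_bigr => i _.
  by rewrite mulr_sumr; apply: eq_bigr => k _; rewrite mulrACA.
rewrite sqnormE mulr_suml; apply: eq_bigr => i _.
rewrite expr2 -(sum_mulr_delta (fun k => u i 0 * u k 0 * Sigma l m)).
by apply: eq_bigr => k _; rewrite mulrA.
Qed.

Let mean_Qz j l m : has_mean P (fun x => Q x j l * z x m) 0.
Proof.
apply: (has_mean_ext (has_mean_sum (index_enum 'I_n) (fun i =>
  has_mean_sum (index_enum 'I_n) (fun k =>
  has_mean_sum (index_enum 'I_n) (fun i' =>
    has_meanZ (M i k * u i' 0) (mean3 i j k l i' m)))))) => [x|].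
  rewrite /Q mulr_suml; apply: eq_bigr => i _.
  rewrite mulr_suml; apply: eq_bigr => k _.
  by rewrite mulr_sumr; apply: eq_bigr => i' _; rewrite mulrACA.
by rewrite !big1// => i _; rewrite big1// => k _; rewrite big1// => k' _; rewrite mulr0.
Qed.

Let mean_entry j l : has_mean P
  (fun x => (Q x j l - \tr M * Sigma j l
             + kappa * (gamma j 0 * z x l + z x j * gamma l 0)) ^+ 2)
  (\tr (M *m M) * (Sigma j j * Sigma l l + Sigma j l ^+ 2)
   + kappa ^+ 2 * (u^T *m u) 0 0 * (gamma j 0 ^+ 2 * Sigma l l
       + 2 * (gamma j 0 * Sigma j l * gamma l 0) + gamma l 0 ^+ 2 * Sigma j j)).
Proof.
set tau := \tr M; set s := Sigma j l; set g := gamma j 0; set h := gamma l 0.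
(* The first group is the centred quadratic part, where the squared mean cancels the (tr M)^2 term
   of [mean_QQ]. The second group has degree 3 or 1 in [E] and mean 0. The third is the square of
   the linear part. *)
have H := has_meanD (has_meanD (has_meanD (mean_QQ j l)
    (has_meanZ (- (2 * tau * s)) (mean_Q j l))) (has_mean_cst P ((tau * s) ^+ 2)))
  (has_meanD (has_meanD
     (has_meanD (has_meanZ (2 * kappa * g) (mean_Qz j l l))
                (has_meanZ (2 * kappa * h) (mean_Qz j l j)))
     (has_meanD (has_meanZ (- (2 * tau * s * kappa * g)) (mean_z l))
                (has_meanZ (- (2 * tau * s * kappa * h)) (mean_z j))))
   (has_meanD (has_meanZ (kappa ^+ 2 * g ^+ 2) (mean_zz l l))
     (has_meanD (has_meanZ (kappa ^+ 2 * (2 * g * h)) (mean_zz j l))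
                (has_meanZ (kappa ^+ 2 * h ^+ 2) (mean_zz j j))))).
apply: (has_mean_ext H) => [x|].
  by move: (Q x j l) (z x l) (z x j) => a b c; ring.
rewrite -/tau -/s; move: (\tr (M *m M)) ((u^T *m u) 0 0) => t2 uu; ring.
Qed.

(** The constants [a] and [b] of the theorem originate here: summing the squares and the diagonal
    products of entries of [Sigma] gives [a], and the last factor becomes [b] when [gamma] is a unit
    eigenvector for the top eigenvalue. *)
Lemma mean_sqnorm_centred_quadratic : has_mean P
  (fun x => \sum_j \sum_l ((\sum_i \sum_k M i k * (E x i j * E x k l))
     - \tr M * Sigma j l
     + kappa * (gamma j 0 * (\sum_i u i 0 * E x i l)
                + (\sum_i u i 0 * E x i j) * gamma l 0)) ^+ 2)
  (\tr (M *m M) * (\tr (Sigma *m Sigma) + (\tr Sigma) ^+ 2)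
   + 2 * kappa ^+ 2 * (u^T *m u) 0 0
     * ((gamma^T *m gamma) 0 0 * \tr Sigma + (gamma^T *m Sigma *m gamma) 0 0)).
Proof.
apply: (has_mean_ext (has_mean_sum (index_enum 'I_p) (fun j =>
  has_mean_sum (index_enum 'I_p) (fun l => mean_entry j l)))) => //.
have trS2 : \tr (Sigma *m Sigma) = \sum_j \sum_l Sigma j l ^+ 2.
  apply: eq_bigr => j _; rewrite mxE; apply: eq_bigr => l _.
  by rewrite (SigmaC l j) expr2.
have quadE : (gamma^T *m Sigma *m gamma) 0 0
    = \sum_j \sum_l gamma j 0 * Sigma j l * gamma l 0.
  rewrite mxE exchange_big; apply: eq_bigr => l _ /=.
  by rewrite mxE mulr_suml; apply: eq_bigr => j _; rewrite mxE.
have trtr : (\tr Sigma) ^+ 2 = \sum_j \sum_l Sigma j j * Sigma l l.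
  rewrite expr2 mulr_suml; apply: eq_bigr => j _.
  by rewrite mulr_sumr.
have gtr : (gamma^T *m gamma) 0 0 * \tr Sigma
    = \sum_j \sum_l gamma j 0 ^+ 2 * Sigma l l.
  rewrite sqnormE mulr_suml; apply: eq_bigr => j _.
  by rewrite mulr_sumr.
have gtr' : (gamma^T *m gamma) 0 0 * \tr Sigma
    = \sum_j \sum_l gamma l 0 ^+ 2 * Sigma j j.
  by rewrite gtr exchange_big.
transitivity (\tr (M *m M) * (\sum_j \sum_l Sigma j l ^+ 2
    + \sum_j \sum_l Sigma j j * Sigma l l)
  + kappa ^+ 2 * (u^T *m u) 0 0 * (\sum_j \sum_l gamma j 0 ^+ 2 * Sigma l l
    + 2 * (\sum_j \sum_l gamma j 0 * Sigma j l * gamma l 0)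
    + \sum_j \sum_l gamma l 0 ^+ 2 * Sigma j j)).
  move: (\tr (M *m M)) (kappa ^+ 2 * _) => t2 kk.
  rewrite [2 * _]mulr_sumr -!big_split !mulr_sumr -!big_split.
  apply: eq_bigr => j _ /=.
  rewrite [2 * _]mulr_sumr -!big_split !mulr_sumr -!big_split.
  by apply: eq_bigr => l _ /=; ring.
rewrite -trS2 -trtr -gtr -gtr' -quadE; ring.
Qed.

End second_moment.

End matrix_gaussian_moments.

(** * The allometric model *)

Lemma S_w_allometric (R : realType) (n p q : nat) (X : 'M[R]_(n, q))
    (mu : 'cV[R]_p) (alpha : 'cV[R]_q) (gamma : 'cV[R]_p) (w : R) (E : 'M[R]_(n, p)) :
  (0 < n)%N -> \rank X = q -> X^T *m ones n = 0 ->
  S_w X w (allometric_response X mu alpha gamma E) =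
    E^T *m weight_mx X w *m E
    + (1 - w) *: (gamma *m (E^T *m (X *m alpha))^T + (E^T *m (X *m alpha)) *m gamma^T)
    + ((1 - w) * enorm (X *m alpha) ^+ 2) *: (gamma *m gamma^T).
Proof.
move=> n0 rX X1; rewrite S_wE; set M := weight_mx X w; set u := X *m alpha.
have MT : M^T = M by exact: weight_mx_sym.
have M1 : M *m ones n = 0 by exact: weight_mx_ones.
have Mu : M *m u = (1 - w) *: u.
  by rewrite /u mulmxA weight_mx_design// -scalemxAl.
have uM : u^T *m M = (1 - w) *: u^T by rewrite -[in LHS]MT -trmx_mul Mu linearZ.
(* [M] annihilates the all-ones vector from either side, so [Y] may be replaced by [Y0], from which
   [mu] has disappeared. *)
set Y := allometric_response _ _ _ _ _; pose Y0 := u *m gamma^T + E.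
have MY : M *m Y = M *m Y0.
  by rewrite /Y /allometric_response -addrA mulmxDr mulmxA M1 mul0mx add0r.
have YM : Y^T *m M = Y0^T *m M by apply: trmx_inj; rewrite !trmx_mul MT !trmxK.
have -> : Y^T *m M *m Y = Y0^T *m M *m Y0 by rewrite YM -!mulmxA MY.
have Y0T : Y0^T = gamma *m u^T + E^T by rewrite /Y0 linearD /= trmx_mul trmxK.
have uu : u^T *m u = (enorm u ^+ 2)%:M by rewrite enorm_sqr -mx11_scalar.
have EuT : (E^T *m u)^T = u^T *m E by rewrite trmx_mul trmxK.
have guM : gamma *m u^T *m M = (1 - w) *: (gamma *m u^T).
  by rewrite -mulmxA uM -scalemxAr.
have EMu : E^T *m M *m (u *m gamma^T) = (1 - w) *: (E^T *m u *m gamma^T).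
  by rewrite mulmxA -(mulmxA _ M) Mu -scalemxAr -scalemxAl.
have guug : gamma *m u^T *m (u *m gamma^T) = enorm u ^+ 2 *: (gamma *m gamma^T).
  by rewrite mulmxA -(mulmxA gamma) uu mul_mx_scalar -scalemxAl.
rewrite Y0T /Y0 mulmxDl guM mulmxDl
  !(mulmxDr _ (u *m gamma^T) E) EMu -!scalemxAl guug scalerA EuT.
rewrite mulmxA scalerDr.
by rewrite [RHS]addrC -!addrA; congr (_ + _); rewrite [RHS]addrC -!addrA.
Qed.

Lemma integral_le_mean (R : realType) (d : measure_display) (T : measurableType d)
    (P : probability T R) (f g : T -> R) (v : R) :
  measurable_fun setT f -> (forall x, 0 <= f x) -> (forall x, f x <= g x) ->
  has_mean P g v -> (\int[P]_x (f x)%:E <= v%:E)%E.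
Proof.
move=> mf f0 fg [gi <-]; apply: ge0_le_integral => //.
- by move=> x _; rewrite lee_fin.
- exact/measurable_EFinP.
- exact: measurable_int gi.
- by move=> x _; rewrite lee_fin.
Qed.

Lemma measurable_enorm_sqr (R : realType) (d : measure_display)
    (T : measurableType d) (k : nat) (v : T -> 'cV[R]_k) :
  random_mx v -> measurable_fun setT (fun x => enorm (v x) ^+ 2).
Proof.
move=> mv; under eq_fun do rewrite enorm_sqr sqnormE.
by apply: measurable_sum => i; exact: measurable_funX.
Qed.

Theorem theorem3p3 (R : realType) (disp : measure_display)
    (T : measurableType disp) (P : probability T R)
    (n p q : nat) (hq : (0 < q)%N) (hp : (2 <= p)%N) (hn : (1 + q < n)%N)
    (X : 'M[R]_(n, q)) (hXrank : \rank X = q) (hX1 : X^T *m ones n = 0)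
    (mu : 'cV[R]_p) (alpha : 'cV[R]_q)
    (Sigma : 'M[R]_p) (hSigma : posdef Sigma)
    (lam : p.-tuple R) (hlam : eigenvalues_of Sigma lam)
    (hlam_sorted : sorted >=%R lam) (hlam12 : lam`_0 > lam`_1)
    (hlam_pos : forall i : 'I_p, 0 < tnth lam i)
    (gamma1 : 'cV[R]_p) (hgamma1 : enorm gamma1 = 1)
    (hgamma1_eig : Sigma *m gamma1 = lam`_0 *: gamma1)
    (E : T -> 'M[R]_(n, p))
    (hE : mvnormal P (fun x => vec (E x)) 0 (Sigma *t 1%:M))
    (Y : T -> 'M[R]_(n, p))
    (hY : forall x, Y x = allometric_response X mu alpha gamma1 (E x))
    (w : R) (hw0 : 0 <= w) (hw1 : w <= 1)
    (gammahat : T -> 'cV[R]_p) (hgammahat_meas : random_mx gammahat)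
    (hgammahat : forall x, principal_eigenvector (S_w X w (Y x)) (gammahat x)) :
  let a := \tr (Sigma *m Sigma) + (\tr Sigma) ^+ 2 in
  let b := lam`_0 + \tr Sigma in
  let c := enorm (X *m alpha) ^+ 2 in
  let d := lam`_0 - lam`_1 in
  ('E_P[fun x => (Num.min (enorm ((-1) *: gammahat x - gamma1) ^+ 2)
                          (enorm (1 *: gammahat x - gamma1) ^+ 2))%R]
   <= ((8 * a * (q%:R * (1 - 2 * w) + (n%:R - 1) * w ^+ 2)
        + 16 * (b * c) * (1 - w) ^+ 2)
       / (d * (q%:R + (n%:R - 1 - 2 * q%:R) * w) + c * (1 - w)) ^+ 2)%R%:E)%E.

Proof.
lazy zeta; set a := \tr (Sigma *m Sigma) + _; set b := lam`_0 + _.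
set c := enorm (X *m alpha) ^+ 2; set d := lam`_0 - _.
have n0 : (0 < n)%N by apply: leq_ltn_trans hn.
set D := d * _ + _; set M := weight_mx X w; set u := X *m alpha.
have [SigmaT _] := hSigma.
have tau_eq : \tr M = q%:R + (n%:R - 1 - 2 * q%:R) * w by exact: mxtrace_weight_mx.
have tau_gt0 : 0 < \tr M.
  rewrite tau_eq.
  have qR : 0 < q%:R :> R by rewrite ltr0n.
  have nR : 0 < n%:R - 1 - q%:R :> R.
    have : (1 + q)%:R < n%:R :> R by rewrite ltr_nat.
    by rewrite natrD; lra.
  (* The trace is a convex combination of q and n - 1 - q, both positive; this is what makes the gap
     [D] positive for every [w]. *)
  have -> : q%:R + (n%:R - 1 - 2 * q%:R) * w
    = q%:R * (1 - w) + (n%:R - 1 - q%:R) * w :> R by ring.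
  have [->|w1] := eqVneq w 1; first by rewrite subrr mulr0 add0r mulr1.
  have wq : 0 < q%:R * (1 - w) by rewrite mulr_gt0// subr_gt0 lt_neqAle w1.
  have wn : 0 <= (n%:R - 1 - q%:R) * w by rewrite mulr_ge0// ltW.
  by rewrite ltr_wpDr.
have d_gt0 : 0 < d by rewrite subr_gt0.
have c_ge0 : 0 <= c by exact: sqr_ge0.
have w1_ge0 : 0 <= 1 - w by rewrite subr_ge0.
have D_gt0 : 0 < D by rewrite /D -tau_eq ltr_wpDr ?(mulr_ge0 c_ge0)// mulr_gt0.
have gg : (gamma1^T *m gamma1) 0 0 = 1 by rewrite -enorm_sqr hgamma1 expr1n.
pose Q : 'M[R]_p := \tr M *: Sigma + ((1 - w) * c) *: (gamma1 *m gamma1^T).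
have QT : Q^T = Q.
  by rewrite /Q trmx_lincomb SigmaT trmx_mul trmxK.
have Qgamma : Q *m gamma1 = (\tr M * lam`_0 + (1 - w) * c) *: gamma1.
  rewrite /Q mulmxDl -!scalemxAl hgamma1_eig -mulmxA (mx11_scalar (_ *m gamma1)) gg.
  by rewrite mulmx1 scalerA scalerDl.
have gamma1_neq0 : gamma1 != 0.
  by apply/eqP => g0; move: gg; rewrite g0 mulmx0 mxE => /esym/eqP; rewrite oner_eq0.
(* On the complement of [gamma1] the rank-one signal vanishes and only the second eigenvalue of
   [Sigma] counts, so the signal adds the whole of (1 - w) c to the gap. *)
have Qorth (v : 'cV[R]_p) : (v^T *m gamma1) 0 0 = 0 ->
    (v^T *m Q *m v) 0 0 <= \tr M * lam`_1 * (v^T *m v) 0 0.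
  move=> vg; rewrite /Q mulmxDr mulmxDl -!scalemxAr -!scalemxAl.
  have -> : v^T *m (gamma1 *m gamma1^T) *m v = 0.
    have vg0 : v^T *m gamma1 = 0 by apply/matrixP => i j; rewrite !ord1 vg mxE.
    by rewrite mulmxA vg0 !mul0mx.
  rewrite scaler0 addr0 mxE -mulrA (ler_wpM2l (ltW tau_gt0))//.
  exact: (symmetric_rayleigh_le_orth hp SigmaT hlam hlam_sorted hlam12 gamma1_neq0).
have gapE : \tr M * lam`_0 + (1 - w) * c - \tr M * lam`_1 = D.
  by rewrite /D -tau_eq /d; ring.
have ST x : (S_w X w (Y x))^T = S_w X w (Y x).
  rewrite S_wE !trmx_mul trmxK mulmxA; congr (_ *m _ *m _); exact: weight_mx_sym.
pose z x l := \sum_i u i 0 * E x i l.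
pose N x := \sum_j \sum_l ((\sum_i \sum_k M i k * (E x i j * E x k l))
     - \tr M * Sigma j l
     + (1 - w) * (gamma1 j 0 * z x l + z x j * gamma1 l 0)) ^+ 2.
have SQE x : \sum_j \sum_l (S_w X w (Y x) j l - Q j l) ^+ 2 = N x.
  apply: eq_bigr => j _; apply: eq_bigr => l _; congr (_ ^+ 2).
  rewrite hY S_w_allometric//.
  have zE m : ((E x)^T *m u) m 0 = z x m.
    by rewrite mxE; apply: eq_bigr => i _; rewrite mxE mulrC.
  have EME : ((E x)^T *m M *m E x) j l = \sum_i \sum_k M i k * (E x i j * E x k l).
    rewrite mxE exchange_big; apply: eq_bigr => k _ /=.
    by rewrite mxE mulr_suml; apply: eq_bigr => i _; rewrite !mxE; ring.
  have gz : (gamma1 *m ((E x)^T *m u)^T) j l = gamma1 j 0 * z x l.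
    by rewrite mxE big_ord1 [_^T _ _]mxE zE.
  have zg : ((E x)^T *m u *m gamma1^T) j l = z x j * gamma1 l 0.
    by rewrite mxE big_ord1 [_^T _ _]mxE zE.
  have add2 (A B : 'M[R]_p) : (A + B) j l = A j l + B j l by rewrite mxE.
  have scale2 k (A : 'M[R]_p) : (k *: A) j l = k * A j l by rewrite mxE.
  by rewrite /Q !(add2, scale2) EME gz zg -/c; ring.
have meanN : has_mean P N (\tr (M *m M) * a + 2 * (1 - w) ^+ 2 * c * b).
  have MT : M^T = M by exact: weight_mx_sym.
  apply: (has_mean_ext
    (mean_sqnorm_centred_quadratic hSigma hE u gamma1 (1 - w) MT)) => //.
  have gSg : (gamma1^T *m Sigma *m gamma1) 0 0 = lam`_0.
    by rewrite -mulmxA hgamma1_eig -scalemxAr mxE gg mulr1.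
  by rewrite -/a gg gSg mul1r -enorm_sqr -/c /b [lam`_0 + _]addrC.
(* The sign, needed for the final doubling, is read off from the mean of the nonnegative [N] instead
   of being checked term by term. *)
have v_ge0 : 0 <= \tr (M *m M) * a + 2 * (1 - w) ^+ 2 * c * b.
  have [_ Nv] := meanN; rewrite -lee_fin -Nv; apply: integral_ge0 => x _.
  by rewrite lee_fin; do 2 apply: sumr_ge0 => ? _; exact: sqr_ge0.
have mY (k : R) : random_mx (fun x => k *: gammahat x - gamma1).
  move=> i j; under eq_fun do rewrite !mxE.
  by apply: measurable_funB => //; exact: measurable_funM.
rewrite unlock.
apply: (@le_trans _ _ (4 / D ^+ 2
    * (\tr (M *m M) * a + 2 * (1 - w) ^+ 2 * c * b))%:E).
  apply: integral_le_mean (has_meanZ (4 / D ^+ 2) meanN).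
  - by apply: measurable_minr; exact: measurable_enorm_sqr.
  - by move=> x; rewrite le_min !sqr_ge0.
  - move=> x; rewrite -SQE mulrAC -gapE.
    apply: principal_eigenvector_perturbation => //.
    by rewrite -subr_gt0 gapE.
rewrite lee_fin mulrAC ler_pM2r ?invr_gt0 ?exprn_gt0//.
have -> : q%:R * (1 - 2 * w) + (n%:R - 1) * w ^+ 2 = \tr (M *m M).
  by rewrite mxtrace_weight_mx_sqr.
have -> : 8 * a * \tr (M *m M) + 16 * (b * c) * (1 - w) ^+ 2
  = 2 * (4 * (\tr (M *m M) * a + 2 * (1 - w) ^+ 2 * c * b)) by ring.
by rewrite ler_peMl ?mulr_ge0// ler1n.
Qed.
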